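(* For all $n,m\ge 0$, the number of Arndt compositions of $n$ with $m$ parts equals the number of reduced anti-palindromic compositions of $n$ with $m$ parts.
   Context: A composition of $n$ is a finite sequence $(\sigma_1,\dots,\sigma_\ell)$ of positive integers summing to $n$, with $\ell$ parts. An Arndt composition is one with $\sigma_{2i-1}>\sigma_{2i}$ for every positive integer $i$ with $2i\le\ell$. A composition is anti-palindromic if $\sigma_i\neq\sigma_{\ell+1-i}$ for all $i$ with $i\neq(\ell+1)/2$. Two anti-palindromic compositions with $\ell$ parts are flip-equivalent if one is obtained from the other by swapping $\sigma_i$ and $\sigma_{\ell+1-i}$ for some set of indices $i<(\ell+1)/2$; a reduced anti-palindromic composition of $n$ with $\ell$ parts is a flip-equivalence class of anti-palindromic compositions of $n$ with $\ell$ parts. *)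

(* Defs.v *)
From mathcomp Require Import all_boot.
From mathcomp Require Import zify.

Set Implicit Arguments.
Unset Strict Implicit.
Unset Printing Implicit Defensive.

(* Parts of a composition of n are at most n, so they are taken in 'I_n.+1 to
   get a finite type; bounded_parts below shows that nothing is lost. *)
Definition compositions (n m : nat) : {set m.-tuple 'I_n.+1} :=
  [set s : m.-tuple 'I_n.+1 |
    [forall i, 0 < tnth s i] && (\sum_(i < m) tnth s i == n)].

(* sigma_k, numbered from 1 *)
Definition part (n m : nat) (s : m.-tuple 'I_n.+1) (k : nat) : nat :=
  nth ord0 s k.-1.

(* The bound i <= m is harmless since only 2i <= m matters. *)
Definition is_arndt (n m : nat) (s : m.-tuple 'I_n.+1) : bool :=
  [forall i : 'I_m.+1,
    (0 < i) && (2 * i <= m) ==> (part s (2 * i - 1) > part s (2 * i))].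

Definition arndt_compositions (n m : nat) : {set m.-tuple 'I_n.+1} :=
  [set s in compositions n m | is_arndt s].

(* Here i : 'I_m stands for the index i.+1, and rev_ord i for m.+1 - i.+1. *)
Definition is_antipalindromic (n m : nat) (s : m.-tuple 'I_n.+1) : bool :=
  [forall i : 'I_m, (2 * i.+1 != m.+1) ==> (tnth s i != tnth s (rev_ord i))].

Definition antipalindromic_compositions (n m : nat) : {set m.-tuple 'I_n.+1} :=
  [set s in compositions n m | is_antipalindromic s].

(* The i : 'I_m whose index i.+1 is smaller than (m + 1) / 2 *)
Definition left_half (m : nat) : {set 'I_m} :=
  [set i : 'I_m | 2 * i.+1 < m.+1].

Definition flip (T : Type) (m : nat) (A : {set 'I_m}) (s : m.-tuple T) :
    m.-tuple T :=
  [tuple if (i \in A) || (rev_ord i \in A) then tnth s (rev_ord i)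
         else tnth s i | i < m].

Definition flip_equiv (n m : nat) : rel (m.-tuple 'I_n.+1) :=
  fun s t => [exists A : {set 'I_m}, (A \subset left_half m) && (t == flip A s)].

Definition reduced_antipalindromic_compositions (n m : nat) :
    {set {set m.-tuple 'I_n.+1}} :=
  equivalence_partition (@flip_equiv n m) (antipalindromic_compositions n m).

Lemma bounded_parts (n m : nat) (s : m.-tuple nat) :
  (forall i, 0 < tnth s i) -> \sum_(i < m) tnth s i = n ->
  exists2 t : m.-tuple 'I_n.+1,
    t \in compositions n m & forall i, tnth t i = tnth s i :> nat.
Proof.
move=> s_gt0 sum_s.
have le_n i : tnth s i < n.+1 by rewrite ltnS -sum_s (bigD1 i) //= leq_addr.
exists [tuple Ordinal (le_n i) | i < m] => [|i]; last by rewrite tnth_mktuple.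
rewrite inE; apply/andP; split; first by apply/forallP=> i; rewrite tnth_mktuple /=.
by apply/eqP; rewrite -[RHS]sum_s; apply: eq_bigr => i _; rewrite tnth_mktuple.
Qed.

Lemma flip_equiv_equivalence (n m : nat) : equivalence_rel (@flip_equiv n m).
Proof.
have fxx (s : m.-tuple 'I_n.+1) : flip_equiv s s.
  apply/existsP; exists set0; rewrite sub0set /=; apply/eqP/eq_from_tnth=> i.
  by rewrite tnth_mktuple !inE.
have flip_sym s t : @flip_equiv n m s t -> flip_equiv t s.
  case/existsP=> A /andP[sA /eqP->]; apply/existsP; exists A; rewrite sA /=.
  apply/eqP/eq_from_tnth=> i; rewrite !tnth_mktuple rev_ordK.
  by case: (i \in A); case: (rev_ord i \in A).
have flip_trans s t u : @flip_equiv n m s t -> flip_equiv t u -> flip_equiv s u.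
  case/existsP=> A /andP[sA /eqP->] /existsP[B /andP[sB /eqP->]].
  have half i : i \in left_half m -> rev_ord i \notin left_half m.
    by rewrite !inE /=; have := ltn_ord i; lia.
  have memN (C : {set 'I_m}) i : C \subset left_half m ->
      i \notin left_half m -> (i \in C) = false.
    by move=> sC; apply: contraNF; apply: (subsetP sC).
  apply/existsP; exists ((A :\: B) :|: (B :\: A)).
  rewrite subUset (subset_trans (subsetDl A B) sA) (subset_trans (subsetDl B A) sB) /=.
  apply/eqP/eq_from_tnth=> i; rewrite !tnth_mktuple !inE rev_ordK.
  have [/half iR | iN] := boolP (i \in left_half m).
    rewrite (memN A _ sA iR) (memN B _ sB iR).
    by case: (i \in A); case: (i \in B).
  rewrite (memN A _ sA iN) (memN B _ sB iN).
  by case: (rev_ord i \in A); case: (rev_ord i \in B).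
move=> s t u; split=> [|st]; first exact: fxx.
by apply/idP/idP; apply: flip_trans => //; apply: flip_sym.
Qed.

(* Main.v *)
Require Import Defs.
From mathcomp Require Import all_boot.
From mathcomp Require Import zify.

(** Every flip class of anti-palindromic compositions contains exactly one
    composition that is decreasing on each mirror pair, i.e. has
    [sigma_i > sigma_(l+1-i)] for all [i < (l+1)/2].  Moving the parts [2i-1]
    and [2i] to the positions [i] and [l+1-i] turns the Arndt condition into
    exactly this one, and permuting positions preserves the sum. *)

Set Implicit Arguments.
Unset Strict Implicit.
Unset Printing Implicit Defensive.

Definition reindex_tuple (T : Type) (m : nat) (q : 'I_m -> 'I_m)
    (s : m.-tuple T) : m.-tuple T :=
  [tuple tnth s (q i) | i < m].

Lemma reindex_tuple_bij (T : Type) (m : nat) (q : 'I_m -> 'I_m) :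
  injective q -> bijective (@reindex_tuple T m q).
Proof.
move=> /injF_bij[r qK rK]; exists (reindex_tuple r) => s.
  by apply: eq_from_tnth => i; rewrite !tnth_mktuple rK.
by apply: eq_from_tnth => i; rewrite !tnth_mktuple qK.
Qed.

Lemma reindex_compositions (n m : nat) (q : 'I_m -> 'I_m)
    (s : m.-tuple 'I_n.+1) :
  injective q -> (reindex_tuple q s \in compositions n m) = (s \in compositions n m).
Proof.
move=> q_inj; rewrite !inE; congr andb.
  have [r qK rK] := injF_bij q_inj.
  apply/forallP/forallP => s_gt0 i; last by rewrite tnth_mktuple.
  by have := s_gt0 (r i); rewrite tnth_mktuple rK.
congr (_ == n); rewrite [RHS](reindex_inj q_inj).
by apply: eq_bigr => i _; rewrite tnth_mktuple.
Qed.

Lemma flip_compositions (n m : nat) (A : {set 'I_m}) (s : m.-tuple 'I_n.+1) :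
  (flip A s \in compositions n m) = (s \in compositions n m).
Proof.
(* The condition is symmetric in [i] and [rev_ord i], so [q] is an involution for every [A], and a
   flip is merely a reindexing. *)
pose q i := if (i \in A) || (rev_ord i \in A) then rev_ord i else i.
have qK : involutive q.
  move=> i; rewrite {2}/q; case: ifP => Ai; last by rewrite /q Ai.
  by rewrite /q rev_ordK orbC Ai.
have -> : flip A s = reindex_tuple q s.
  by apply: eq_from_tnth => i; rewrite !tnth_mktuple /q; case: ifP.
exact: reindex_compositions (inv_inj qK).
Qed.

Lemma rev_ord_left_half (m : nat) (i : 'I_m) :
  2 * i.+1 != m.+1 -> i \notin left_half m -> rev_ord i \in left_half m.
Proof. by rewrite !inE /=; have := ltn_ord i; lia. Qed.

Definition mirror_decreasing (n m : nat) : {set m.-tuple 'I_n.+1} :=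
  [set s in compositions n m |
    [forall i in left_half m, tnth s (rev_ord i) < tnth s i]].

Lemma mirror_decreasing_antipalindromic (n m : nat) :
  mirror_decreasing n m \subset antipalindromic_compositions n m.
Proof.
apply/subsetP => s; rewrite [s \in _]inE => /andP[sC /forall_inP s_dec].
rewrite inE sC; apply/forallP => i; apply/implyP => i_mid.
have [/s_dec|iR] := boolP (i \in left_half m).
  by apply: contraTneq => ->; rewrite ltnn.
have := s_dec _ (rev_ord_left_half i_mid iR); rewrite rev_ordK.
by apply: contraTneq => ->; rewrite ltnn.
Qed.

(** Flip exactly the mirror pairs that stand in increasing order. Anti-palindromicity excludes ties,
    so every pair becomes strictly decreasing. *)
Lemma flip_equiv_mirror_decreasing (n m : nat) (s : m.-tuple 'I_n.+1) :
  s \in antipalindromic_compositions n m ->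
  exists2 t, t \in mirror_decreasing n m & flip_equiv s t.
Proof.
rewrite inE => /andP[sC /forallP s_anti].
pose A := [set i in left_half m | tnth s i < tnth s (rev_ord i)].
have sA : A \subset left_half m by apply/subsetP => i; rewrite inE => /andP[].
exists (flip A s); last by apply/existsP; exists A; rewrite sA /=.
rewrite inE flip_compositions sC; apply/forall_inP => i iL.
have iR : rev_ord i \notin left_half m.
  by move: iL; rewrite !inE /=; have := ltn_ord i; lia.
have iRA : (rev_ord i \in A) = false.
  by apply: contraNF iR; apply: (subsetP sA).
have iA : (i \in A) = (tnth s i < tnth s (rev_ord i)) by rewrite inE iL.
have s_neq : tnth s i != tnth s (rev_ord i).
  by apply: (implyP (s_anti i)); move: iL; rewrite inE; lia.
rewrite !tnth_mktuple rev_ordK iRA orbF /= iA.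
by case: (ltnP (tnth s i)) => // ge_s; rewrite ltn_neqAle ge_s andbT eq_sym.
Qed.

(** A flip at [i] reverses the strict order of that pair, so it cannot lead from one
    mirror-decreasing composition to another; hence [A] is empty. *)
Lemma mirror_decreasing_flip_inj (n m : nat) (s t : m.-tuple 'I_n.+1) :
  s \in mirror_decreasing n m -> t \in mirror_decreasing n m ->
  flip_equiv s t -> s = t.
Proof.
rewrite !inE => /andP[_ /forall_inP s_dec] /andP[_ /forall_inP t_dec].
case/existsP => A /andP[sA /eqP t_flip].
have A0 i : (i \in A) = false.
  apply/negP => iA; have iL := subsetP sA i iA.
  have := t_dec i iL; rewrite t_flip !tnth_mktuple rev_ordK iA orbT /=.
  by move=> /ltn_trans/(_ (s_dec i iL)); rewrite ltnn.
by rewrite t_flip; apply: eq_from_tnth => i; rewrite tnth_mktuple !A0.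
Qed.

Lemma card_reduced_antipalindromic (n m : nat) :
  #|reduced_antipalindromic_compositions n m| = #|mirror_decreasing n m|.
Proof.
have flipE := @flip_equiv_equivalence n m.
pose D := antipalindromic_compositions n m.
pose class s := [set t in D | flip_equiv s t].
have subD := subsetP (mirror_decreasing_antipalindromic n m).
have -> : reduced_antipalindromic_compositions n m
          = class @: mirror_decreasing n m.
  apply/setP => X; apply/imsetP/imsetP => [[s sD ->]|[s sM ->]]; last first.
    by exists s; first exact: subD.
  (* Every class is the class of its mirror-decreasing member. *)
  have [t tM st] := flip_equiv_mirror_decreasing sD; exists t => //.
  by apply/setP => u; rewrite !inE (flipE s t u).2.
apply: card_in_imset => s t sM tM /setP/(_ t).
(* Since [t] lies in its own class, equality of the classes puts it in the class of [s]. *)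
rewrite [LHS]inE [RHS]inE (subD t tM) (flipE t t t).1.
exact: mirror_decreasing_flip_inj.
Qed.

Lemma unfold_pos_subproof (m : nat) (j : 'I_m) :
  (if odd j then m.-1 - j./2 else j./2) < m.
Proof. by have := ltn_ord j; case: ifP; lia. Qed.

(* In 0-based positions, [2i] goes to [i] and [2i+1] to the mirror of [i]. *)
Definition unfold_pos (m : nat) (j : 'I_m) : 'I_m :=
  Ordinal (unfold_pos_subproof j).

Lemma unfold_pos_inj (m : nat) : injective (@unfold_pos m).
Proof.
move=> j k /(congr1 val) /= jk; apply: val_inj => /=.
(* For opposite parities, equal images would force [j + k = 2m - 1], although both are at most
   [m - 1]. *)
by move: jk (ltn_ord j) (ltn_ord k); case: ifP; case: ifP; lia.
Qed.

Lemma is_arndt_unfold (n m : nat) (s : m.-tuple 'I_n.+1) :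
  is_arndt (reindex_tuple (@unfold_pos m) s)
  = [forall i in left_half m, tnth s (rev_ord i) < tnth s i].
Proof.
set t := reindex_tuple _ s.
have tE (i : 'I_m) : i \in left_half m ->
    part t (2 * i.+1 - 1) = tnth s i /\ part t (2 * i.+1) = tnth s (rev_ord i).
  (* The 0-based positions of these parts are [2i] and [2i+1]. Both are in range for [i] in the left
     half, so the default [ord0] of [part] never occurs. *)
  rewrite inE => iL; have even_lt : (2 * i.+1 - 1).-1 < m by lia.
  have odd_lt : (2 * i.+1).-1 < m by lia.
  have nthE k (lt_k : k < m) : nth ord0 t k = tnth s (unfold_pos (Ordinal lt_k)).
    by rewrite -[RHS](tnth_mktuple (fun j => tnth s (unfold_pos j))) (tnth_nth ord0).
  rewrite /part (nthE _ even_lt) (nthE _ odd_lt).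
  by split; congr (val (tnth s _)); apply: val_inj => /=; case: ifP; lia.
apply/forallP/forall_inP => [t_arndt i iL|s_dec i].
  have lt_i : i.+1 < m.+1 by rewrite ltnS.
  have := t_arndt (Ordinal lt_i); rewrite /= (tE i iL).1 (tE i iL).2.
  by move/implyP; apply; move: iL; rewrite inE; lia.
(* The Arndt index is 1-based: [i] corresponds to the position [i.-1], and [2 * i <= m] says that it
   is in the left half. *)
apply/implyP => /andP[i_gt0 le_im].
have lt_i : i.-1 < m by lia.
have iL : Ordinal lt_i \in left_half m by rewrite inE /=; lia.
by have [] := tE _ iL; rewrite /= prednK // => -> ->; apply: s_dec.
Qed.

Lemma card_arndt (n m : nat) :
  #|arndt_compositions n m| = #|mirror_decreasing n m|.
Proof.
have f_bij := reindex_tuple_bij 'I_n.+1 (@unfold_pos_inj m).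
(* The mirror-decreasing compositions are the preimage of the Arndt compositions under the bijective
   reindexing. *)
rewrite -(on_card_preimset (onW_bij _ f_bij)); apply: eq_card => s.
rewrite [LHS]inE [LHS]inE [RHS]inE is_arndt_unfold reindex_compositions //.
exact: unfold_pos_inj.
Qed.

Theorem theorem2p10 (n m : nat) :
  #|arndt_compositions n m| = #|reduced_antipalindromic_compositions n m|.
Proof. by rewrite card_arndt card_reduced_antipalindromic. Qed.
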